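(* Let $p$ be a prime with $p\leqslant 3$ and let $G$ be a finite $p$-group that is a $\mathcal{DC}$-group. Then $G$ is metabelian, i.e. $G'$ is abelian.
   Context: For a group $H$, $H'$ denotes its derived (commutator) subgroup. A group $G$ is called a $\mathcal{DC}$-group if the set $\{H' \mid H\leq G\}$ is a chain with respect to inclusion, i.e. for all subgroups $H,K\leq G$ one has $H'\leq K'$ or $K'\leq H'$. *)

(* Defs.v *)
From mathcomp Require Import all_boot all_fingroup all_solvable.

Set Implicit Arguments.
Unset Strict Implicit.
Unset Printing Implicit Defensive.

Local Open Scope group_scope.

Definition DC_group (gT : finGroupType) (G : {group gT}) : Prop :=
  forall H K : {group gT}, H \subset G -> K \subset G ->
    H^`(1) \subset K^`(1) \/ K^`(1) \subset H^`(1).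

Definition metabelian (gT : finGroupType) (G : {group gT}) : bool :=
  abelian G^`(1).

(* Main.v *)
(**
In a minimal counterexample [G] is generated by two elements [x], [y], and
[G''] is central of order [p].  Put [c = [x,y]], [d = [c,x]], [e = [c,y]],
[q = c^p] and [t = [x^p,y]].  The chain condition yields an abelian normal
subgroup [K] containing [d, e, q, t] with [G' = <c>K]; one may choose [x] and [y]
so that [z = [d,c]] generates [G''] while [e] commutes with [c].  Written
additively, [K] carries the commuting-up-to-[D] operators [T = x-1], [S = y-1],
where [D = c-1] has image [<z>], and [S t] equals [z] plus the trace
[e + e^x + ... + e^(x^(p-1))]; this is where [p <= 3] enters.

Comparing derived subgroups of two-generator subgroups then shows that [e] lies
in [T K], that [T K = [K,G]], and that every commutator of order [p] commuting
with its two entries lies in [<z>].  If [t] is not in [T K], then [T K] is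
contained in [<x^p,y>'], which forces [T K] to be cyclic inside [<p t>], and [K]
splits in a way that makes [D] vanish.  Otherwise [p = 3] and [K] is a cyclic
[Z[T]]-module generated by [d]; commutators with [x^3] force [T^3 = 0], and
then [[d, x y^i]] for a suitable [i] is a small commutator outside [<z>].
*)
Require Import Defs.
From HB Require Import structures.
From mathcomp Require Import all_boot all_algebra all_fingroup all_solvable.
From mathcomp Require Import zify.
Set Implicit Arguments.
Unset Strict Implicit.
Unset Printing Implicit Defensive.
Import GRing.Theory.
Local Open Scope ring_scope.

(** * Subgroups of a finite abelian group as closed predicates *)

Section Subgroups.
Variable U : finZmodType.

Definition img (F : U -> U) : {pred U} := [pred u | [exists k, u == F k]].
Definition multiples (t : U) : {pred U} := [pred u | u \in <[t]>%g].
Definition sump (A B : {pred U}) : {pred U} :=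
  [pred u | [exists v, (v \in A) && (u - v \in B)]].

Lemma imgP (F : U -> U) u : reflect (exists k, u = F k) (u \in img F).
Proof. by apply: (iffP existsP) => -[k /eqP]; exists k. Qed.

Lemma img_mem (F : U -> U) k : F k \in img F.
Proof. by apply/imgP; exists k. Qed.

Lemma multiplesP t u : reflect (exists a, u = t *+ a) (u \in multiples t).
Proof.
rewrite inE; apply: (iffP (cycleP t u)) => -[a ->]; exists a;
  by rewrite FinRing.zmodXgE.
Qed.

Lemma multiples_id t a : t *+ a \in multiples t.
Proof. by apply/multiplesP; exists a. Qed.

Lemma sumpP (A B : {pred U}) u :
  reflect (exists v w, [/\ v \in A, w \in B & u = v + w]) (u \in sump A B).
Proof.
apply: (iffP existsP) => [[v /andP[Av Buv]] | [v [w [Av Bw ->]]]].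
  by exists v, (u - v); rewrite Av Buv addrC subrK.
by exists v; rewrite Av addrC addKr.
Qed.

Lemma sump_add (A B : {pred U}) v w :
  v \in A -> w \in B -> v + w \in sump A B.
Proof. by move=> Av Bw; apply/sumpP; exists v, w. Qed.

Lemma img_zmod_closed (F : {additive U -> U}) : zmod_closed (img F).
Proof.
split=> [|_ _ /imgP[u ->] /imgP[v ->]]; last by rewrite -raddfB img_mem.
by apply/imgP; exists 0; rewrite raddf0.
Qed.
HB.instance Definition _ F :=
  GRing.isZmodClosed.Build U (img (GRing.Additive.sort F)) (img_zmod_closed F).

Lemma multiples_zmod_closed t : zmod_closed (multiples t).
Proof.
split=> [|u v tu tv]; rewrite inE; first exact: group1.
exact: (groupM tu (groupVr tv)).
Qed.
HB.instance Definition _ t :=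
  GRing.isZmodClosed.Build U (multiples t) (multiples_zmod_closed t).

Lemma sump_zmod_closed (A B : zmodClosed U) : zmod_closed (sump A B).
Proof.
split=> [|_ _ /sumpP[u [v [Au Bv ->]]] /sumpP[u' [v' [Au' Bv' ->]]]].
  by apply/sumpP; exists 0, 0; rewrite !rpred0 addr0.
by rewrite opprD addrACA sump_add ?rpredB.
Qed.
HB.instance Definition _ (A B : zmodClosed U) :=
  GRing.isZmodClosed.Build U (sump A B) (sump_zmod_closed A B).

Lemma mem_sumpl (A : {pred U}) (B : zmodClosed U) u : u \in A -> u \in sump A B.
Proof. by move=> Au; rewrite -[u]addr0 sump_add ?rpred0. Qed.

Lemma mem_sumpr (A : zmodClosed U) (B : {pred U}) u : u \in B -> u \in sump A B.
Proof. by move=> Bu; rewrite -[u]add0r sump_add ?rpred0. Qed.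

(** A Nakayama-type argument: iterating the last hypothesis writes [u] as [F^n v] modulo [J], and
    [F^n] vanishes. *)
Lemma nilpotent_absorb (J : zmodClosed U) (F : U -> U) (A : U -> Prop) n :
    {morph F : u v / u - v} -> (forall u, iter n F u = 0) ->
    {in J, forall u, F u \in J} ->
    (forall u, A u -> exists2 v, A v & u - F v \in J) ->
  forall u, A u -> u \in J.
Proof.
move=> FB Fn JF AJ u Au.
have iterB m v w : iter m F (v - w) = iter m F v - iter m F w.
  by elim: m => //= m ->.
have iterJ m : {in J, forall v, iter m F v \in J}.
  by elim: m => //= m IHm v Jv; apply/JF/IHm.
suffices [v _] : exists2 v, A v & u - iter n F v \in J by rewrite Fn subr0.
elim: (n) => [|m [v Av Juv]]; first by exists u => //=; rewrite subrr rpred0.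
have [w Aw /(iterJ m)] := AJ v Av; rewrite iterB -iterSr => Jvw.
by exists w; rewrite // -[u](subrK (iter m F v)) -addrA rpredD.
Qed.

Section PGroup.
Variable p : nat.
Hypotheses (p_pr : prime p) (pU : p.-nat #|U|).

Lemma mulrn_card (u : U) : u *+ #|U| = 0.
Proof.
by rewrite -FinRing.zmodXgE -cardsT expg_cardG ?inE.
Qed.

(** By Bezout, multiplication by [a] is invertible modulo the order of [U]. *)
Lemma mem_coprime_mulrn (J : zmodClosed U) u a :
  ~~ (p %| a)%N -> u *+ a \in J -> u \in J.
Proof.
move=> p'a Jua; have a_gt0: (0 < a)%N by case: (a) p'a; rewrite ?dvdn0.
have: coprime a #|U| by rewrite coprime_sym (pnat_coprime pU) // p'natE.
case: (egcdnP #|U| a_gt0) => km kn def_km _ /eqP co_a.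
rewrite co_a in def_km.
have: u *+ (km * a) \in J by rewrite mulnC mulrnA rpredMn.
by rewrite def_km mulrnDr mulnC mulrnA mulrn_card mul0rn add0r.
Qed.

Lemma exists_order_p (w : U) :
  w != 0 -> exists2 a, w *+ a != 0 & w *+ a *+ p = 0.
Proof.
have [n def_n] := p_natP pU; move=> nz_w.
have ex_j: exists j, w *+ (p ^ j) == 0 by exists n; rewrite -def_n mulrn_card.
case: (ex_minnP ex_j) => -[|j] /eqP wj0 min_j.
  by rewrite expn0 mulr1n in wj0; rewrite wj0 eqxx in nz_w.
exists (p ^ j)%N; last by rewrite -mulrnA -expnSr.
by apply/negP => /min_j; rewrite ltnn.
Qed.

End PGroup.
End Subgroups.

(** A named function, so that multiplication by [n] can carry an additive structure and be composed
    with [T]. *)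
Definition scalen (U : zmodType) n (u : U) := u *+ n.
Lemma scalen_is_zmod_morphism (U : zmodType) n : zmod_morphism (@scalen U n).
Proof. by move=> u v; rewrite /scalen mulrnBl. Qed.
HB.instance Definition _ (U : zmodType) n :=
  GRing.isZmodMorphism.Build U U (@scalen U n) (@scalen_is_zmod_morphism U n).

(** * The module argument *)

(* [T], [S], [D] stand for [u |-> [u,x]], [[u,y]], [[u,c]] on the abelian group
   [U = K], and [trace], [tail] are defined so that [T \o trace] is [x^p - 1] and
   [t] is [q + tail d] up to a multiple of [z]. *)
Section Module.
Variables (U : finZmodType) (p nT nS : nat) (T S D : {additive U -> U}).
Variables d q e z : U.

Definition trace (u : U) :=
  if p == 2%N then u *+ 2 + T u else u *+ 3 + T u *+ 3 + T (T u).
Definition tail (u : U) := if p == 2%N then u else u *+ 3 + T u.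

Hypotheses (p_pr : prime p) (p_le3 : (p <= 3)%N) (pU : p.-nat #|U|).
Hypothesis Tn : forall u, iter nT T u = 0.
Hypothesis Sn : forall u, iter nS S u = 0.
Hypotheses (nz_z : z != 0) (pz : z *+ p = 0) (Tz : T z = 0) (Sz : S z = 0).
Hypothesis D_z : forall u, D u \in multiples z.
Hypothesis DT : forall u, D (T u) = 0.
Hypothesis STE : forall u, S (T u) = T (S u) + D u.
Hypotheses (Dd : D d = z) (Dq : D q = 0) (De : D e = 0).
Hypotheses (Sd : S d = z + T e) (Sq : S q = e *+ p).
Hypothesis Tq : T q = d *+ p + z *+ 'C(p, 2).
Hypothesis e_gen : exists a b k, e = d *+ a + z *+ b + T k.
Hypothesis U_gen :
  forall u, exists a b b' k k', u = d *+ a + q *+ b + e *+ b' + T k + S k'.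
Variable t : U.
Hypothesis t_def : exists m, t = q + tail d + z *+ m.
(** Here [g] is the action of [x y^i] on [K] and [w] is [[k, x y^i]]. The next two hypotheses
    express the chain condition for [<x^p, y>'] and for commutators with [x^p]. *)
Hypothesis small_comm : forall i k,
  let g u := iter i (fun v => v + S v) (u + T u) in
  let w := g k - k in w *+ p = 0 -> g w = w -> w \in multiples z.
Hypothesis t_comm : t \notin img T -> forall J : zmodClosed U, t \in J ->
  {in J, forall u, S u \in J} -> {in J, forall u, T (trace u) \in J} ->
  forall k, T k \in J.
Hypothesis small_commX : p = 3%N -> forall w,
  w = T t \/ (exists u, w = T (trace u)) ->
  w *+ p = 0 -> T (trace w) = 0 -> D w = 0 -> w \in multiples z.

Let pr23 : p = 2%N \/ p = 3%N.
Proof. by case: p p_pr p_le3 => [|[|[|[|]]]] //; [left | right]. Qed.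

Let Dz : D z = 0.
Proof.
have := STE z; rewrite Tz Sz !raddf0 add0r; exact: esym.
Qed.

Lemma T_neq0 : exists k, T k != 0.
Proof.
apply/existsP; apply: contraT; rewrite negb_exists => /forallP T0.
have {}T0 u : T u = 0 by apply/eqP; have := T0 u; rewrite negbK.
by have := STE d; rewrite !T0 raddf0 Dd add0r => z0; case/eqP: nz_z.
Qed.

Lemma small_commT k : T k *+ p = 0 -> T (T k) = 0 -> T k \in multiples z.
Proof.
move=> pTk TTk; have:= small_comm (i := 0) (k := k); rewrite /=.
by rewrite [k + _]addrC addrK; apply; rewrite // TTk addr0.
Qed.

Lemma sub_multiples_z o (J : zmodClosed U) :
  o \in multiples z -> o != 0 -> o \in J -> z \in J.
Proof.
case/multiplesP=> a -> nz_za; apply: (mem_coprime_mulrn p_pr pU).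
by apply: contra nz_za => /dvdnP[b ->]; rewrite mulnC mulrnA pz mul0rn.
Qed.

(** The last nonzero iterate of [T] on some [T k], scaled to order [p], is a commutator with [x]
    killed by [T]; it lies in [<z>] by [small_commT], hence generates it. *)
Lemma z_img : z \in img T.
Proof.
have [k nzTk] := T_neq0.
have ex_n : exists n, iter n T (T k) == 0.
  by exists nT; rewrite Tn.
case: (ex_minnP ex_n) => -[|n]; first by rewrite /= (negPf nzTk).
move=> /eqP w0 /(_ n); rewrite ltnn => /contra_notN/(_ notF)nz_w.
have [a nz_wa pwa] := exists_order_p pU nz_w.
have w_def : iter n T (T k) *+ a = T (iter n T k *+ a).
  by rewrite -iterSr iterS raddfMn.
have TT : T (iter n T (T k) *+ a) = 0 by rewrite raddfMn -iterS w0 mul0rn.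
rewrite w_def in pwa nz_wa TT.
apply: sub_multiples_z nz_wa (img_mem _ _).
exact: small_commT.
Qed.

Lemma multiples_z_img u : u \in multiples z -> u \in img T.
Proof. by case/multiplesP=> a ->; rewrite rpredMn ?z_img. Qed.

Lemma dp_img : d *+ p \in img T.
Proof.
have ->: d *+ p = T q - z *+ 'C(p, 2) by rewrite Tq addrK.
by rewrite rpredB ?img_mem ?rpredMn ?z_img.
Qed.

Lemma dvd_p_D a : D (d *+ a) = 0 -> (p %| a)%N.
Proof.
move=> Dda; apply: contraNT nz_z => p'a.
(* The trivial subgroup is expressed as the image of the zero map to obtain a closed predicate. *)
have: z \in img (fun _ : U => 0).
  apply: (@mem_coprime_mulrn _ p p_pr pU (img (\0 : {additive U -> U}))) p'a _.
  by rewrite -Dd -raddfMn Dda rpred0.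
by case/imgP=> _ ->.
Qed.

(** Applying [D] to [e_gen] leaves only [D (d *+ a) = 0], so [p] divides [a], and [d *+ p] is in
    [T U]. *)
Lemma e_img : e \in img T.
Proof.
have [a [b [k def_e]]] := e_gen.
have: D (d *+ a) = 0.
  have := De; rewrite {1}def_e !raddfD /= DT addr0 [D (z *+ b)]raddfMn.
  by rewrite Dz mul0rn addr0.
case/dvd_p_D/dvdnP=> a' def_a; rewrite def_e def_a mulnC mulrnA.
by rewrite !rpredD ?img_mem // rpredMn ?dp_img ?z_img.
Qed.

Lemma S_img_T : {in img T, forall u, S u \in img T}.
Proof.
move=> _ /imgP[k ->]; rewrite STE rpredD ?img_mem //.
exact/multiples_z_img/D_z.
Qed.

(** Applying [S] to [U_gen] leaves [S (S k')] modulo [T U]; nilpotency of [S] absorbs this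
    remainder. *)
Lemma S_img u : S u \in img T.
Proof.
have SB : {morph S : u v / u - v} by exact: raddfB.
apply: (nilpotent_absorb SB Sn S_img_T (A := fun v => exists w, v = S w)).
  move=> _ [{}u ->]; have [a [b [b' [k [k' def_u]]]]] := U_gen u.
  exists (S k'); first by exists k'.
  rewrite def_u !raddfD /= addrK !raddfMn Sd Sq.
  rewrite !rpredD ?rpredMn ?rpredD ?z_img ?img_mem ?rpredMn ?e_img //;
    by rewrite S_img_T ?e_img ?img_mem.
by exists u.
Qed.

Lemma U_gen2 u : exists a b k, u = d *+ a + q *+ b + T k.
Proof.
have [a [b [b' [k [k' ->]]]]] := U_gen u; exists a, b.
have /imgP[k2 def_k2]: e *+ b' + T k + S k' \in img T.
  by rewrite !rpredD ?rpredMn ?e_img ?img_mem ?S_img.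
by exists k2; rewrite -def_k2 !addrA.
Qed.

(** For [p = 2] the summand [z] comes from [S d]; for [p = 3] it is [D d], arising from [S (T d)],
    while [S (d *+ 3)] contributes [3z = 0]. *)
Lemma S_t : S t = trace e + z.
Proof.
have [m ->] := t_def.
rewrite !raddfD /= Sq raddfMn Sz mul0rn addr0 /tail /trace.
case: pr23 pz => -> /= pz'; first by rewrite Sd [z + _]addrC addrA.
rewrite raddfD /= [S (d *+ 3)]raddfMn STE Sd [T (_ + _)]raddfD /= Tz add0r Dd mulrnDl.
by rewrite pz' add0r !addrA.
Qed.

Lemma img_TT k : T (T k) \in img (T \o T).
Proof. exact: (img_mem (T \o T)). Qed.

Lemma img_Tp k n : n = p -> T k *+ n \in img (T \o scalen p).
Proof. by move=> ->; rewrite -raddfMn; exact: (img_mem (T \o scalen p)). Qed.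

Lemma T_trace u : T (trace u) \in sump (img (T \o T)) (img (T \o scalen p)).
Proof.
rewrite /trace; case: pr23 => p_eq; rewrite {1}p_eq /= addrC.
  by rewrite raddfD [T (_ *+ _)]raddfMn sump_add ?img_TT ?img_Tp.
by rewrite -mulrnDl raddfD [T (_ *+ _)]raddfMn sump_add ?img_TT ?img_Tp.
Qed.

Lemma D_eq0 u : T u \in multiples z -> S u \in multiples z -> D u = 0.
Proof.
case/multiplesP=> a Tu /multiplesP[b Su].
by have := STE u; rewrite Tu Su !raddfMn /= Tz Sz !mul0rn add0r.
Qed.

Lemma S_TT k : S (T (T k)) = T (T (S k)).
Proof.
rewrite STE DT addr0 STE raddfD /=; have /multiplesP[m ->] := D_z k.
by rewrite [T (z *+ m)]raddfMn Tz mul0rn addr0.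
Qed.

Lemma S_Tp k : S (T (scalen p k)) = T (S k) *+ p.
Proof.
rewrite /scalen raddfMn [S _]raddfMn /= STE mulrnDl.
have /multiplesP[m ->] := D_z k.
by rewrite mulrnAC pz mul0rn addr0.
Qed.

Lemma t_img : t \in img T.
Proof.
apply: contraNT nz_z => t'T.
pose B := sump (img (T \o T)) (img (T \o scalen p)).
have sBT : {subset B <= img T}.
  move=> _ /sumpP[_ [_ [/imgP[k ->] /imgP[k' ->] ->]]].
  by rewrite rpredD /= ?img_mem.
(* [J] contains [t] and is stable under [S], because [S t = trace e + z] with [e] in [T U], and
   under [x^p - 1], whose values lie in [B]. *)
pose J := sump (sump (multiples t) (multiples z)) B.
have BJ u : u \in B -> u \in J by exact: mem_sumpr.
have zJ : z \in J.
  by apply: mem_sumpl; apply: mem_sumpr; rewrite -[z]mulr1n multiples_id.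
have TJ k : T k \in J.
  apply: (t_comm t'T).
  - by apply: mem_sumpl; apply: mem_sumpl; rewrite -[X in X \in _]mulr1n multiples_id.
  - move=> _ /sumpP[_ [_ [/sumpP[_ [_ [/multiplesP[a ->] /multiplesP[b ->] ->]]]
      /sumpP[_ [_ [/imgP[k1 ->] /imgP[k2 ->] ->]]] ->]]].
    rewrite !raddfD /= [S (t *+ a)]raddfMn [S (z *+ b)]raddfMn /= Sz mul0rn addr0 S_t.
    apply: rpredD.
      rewrite rpredMn // rpredD //; have /imgP[u ->] := e_img.
      rewrite /trace; apply: BJ; case: pr23 => p_eq; rewrite {1}p_eq /= addrC.
        by rewrite sump_add ?img_TT ?img_Tp.
      by rewrite -mulrnDl -raddfD sump_add ?img_TT ?img_Tp.
    by apply: BJ; rewrite S_TT S_Tp sump_add ?img_TT ?img_Tp.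
  by move=> u _; apply/BJ/T_trace.
have TJ1 k : exists a b k1 k2,
    T k = t *+ p *+ a + z *+ b + (T (T k1) + T k2 *+ p).
  have /sumpP[_ [w [/sumpP[_ [_ [/multiplesP[a ->] /multiplesP[b ->] ->]]] Bw
      def_Tk]]] := TJ k.
  (* A coefficient of [t] prime to [p] would put [t] in [T U]. *)
  have /dvdnP[a' def_a] : (p %| a)%N.
    apply: contraNT t'T => p'a; apply: (mem_coprime_mulrn p_pr pU p'a).
    have ->: t *+ a = T k - w - z *+ b by rewrite def_Tk !addrK.
    by rewrite !rpredB ?img_mem ?rpredMn ?z_img ?sBT.
  case/sumpP: Bw def_Tk => _ [_ [/imgP[k1 ->] /imgP[k2 ->] ->]] ->.
  by exists a', b, k1, k2; rewrite def_a mulnC mulrnA /= [T (scalen _ _)]raddfMn.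
(* Modulo [p T U], [T^2 k] equals [T (T^2 k1)]; nilpotency of [T] then gives [T^2 U] inside
   [p T U]. *)
have TTp k : T (T k) \in img (T \o scalen p).
  have TB : {morph T : u v / u - v} by exact: raddfB.
  apply: (nilpotent_absorb TB Tn (A := fun v => exists k, v = T (T k))).
  - by move=> _ /imgP[u ->] /=; rewrite [T (scalen _ _)]raddfMn [T (_ *+ _)]raddfMn;
    exact: img_Tp.
  - move=> _ [{}k ->]; have [a [b [k1 [k2 ->]]]] := TJ1 k.
    exists (T (T k1)); first by exists k1.
    rewrite !raddfD /= [T (z *+ b)]raddfMn Tz mul0rn addr0.
    rewrite [X in X - _]addrCA [_ - _]addrC addKr.
    rewrite mulrnAC [T (_ *+ p)]raddfMn [T (_ *+ p)]raddfMn -mulrnDl.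
    by rewrite -raddfD; exact: img_Tp.
  by exists k.
(* Now [T k] is [p] times another image modulo [<p t> + <z>], and multiplication by [p] is
   nilpotent. *)
have TJ2 k : T k \in sump (multiples (t *+ p)) (multiples z).
  have [n def_n] := p_natP pU.
  have pB : {morph @scalen U p : u v / u - v} by exact: raddfB.
  have pn (u : U) : iter n (scalen p) u = 0.
    suffices ->: iter n (scalen p) u = u *+ (p ^ n) by rewrite -def_n mulrn_card.
    by elim: (n) => [|m /= ->]; rewrite ?expn0 ?mulr1n // /scalen -mulrnA -expnSr.
  apply: (nilpotent_absorb pB pn (A := fun v => exists k, v = T k)).
  - by move=> u Ju; exact: rpredMn.
  - move=> _ [{}k ->]; have [a [b [k1 [k2 ->]]]] := TJ1 k.
    have /imgP[k3 ->] := TTp k1; exists (T (k3 + k2)); first by exists (k3 + k2).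
    rewrite /= [T (scalen _ _)]raddfMn -mulrnDl -raddfD addrK.
    by rewrite sump_add ?multiples_id.
  by exists k.
have Tpt w : w \in multiples (t *+ p) -> w *+ p = 0 -> T w = 0.
  case/multiplesP=> a -> pw0.
  have /sumpP[_ [_ [/multiplesP[a2 ->] /multiplesP[b2 ->] Tt]]] := TJ2 t.
  rewrite !raddfMn /= Tt !mulrnDl -[z *+ b2 *+ p]mulrnA mulnC mulrnA pz !mul0rn.
  have Ea: (p * a2 * p * a = p * a * p * a2)%N by lia.
  by rewrite addr0 -!mulrnA !mulnA Ea !mulrnA pw0 mul0rn.
(* Otherwise a nonzero component in [<p t>], scaled to order [p], would be a small commutator
   generating [<z>]. So [T U], and with it [S U], would lie in [<z>], forcing [D d = 0]. *)
have zt : z \in multiples (t *+ p).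
  apply: contraT => zt'; case/eqP: nz_z; rewrite -Dd.
  have Tz_mult k : T k \in multiples z.
    have /sumpP[v [w [tv zw def_Tk]]] := TJ2 k.
    have [v0 | nz_v] := eqVneq v 0; first by rewrite def_Tk v0 add0r.
    have [a nz_va pva] := exists_order_p pU nz_v.
    case/negP: zt'; apply: (sub_multiples_z _ nz_va); last exact: rpredMn.
    have /imgP[k' def_v]: v *+ a \in img T.
      rewrite rpredMn // -[v](addrK w) -def_Tk rpredB ?img_mem //.
      exact: multiples_z_img.
    rewrite def_v small_commT -?def_v // Tpt //; exact: rpredMn.
  apply: D_eq0 => //.
  by have /imgP[k ->] := S_img d.
have {}TJ k : T k \in multiples (t *+ p).
  have /sumpP[v [w [tv zw ->]]] := TJ2 k; rewrite rpredD //.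
  by case/multiplesP: zw => b ->; rewrite rpredMn.
have /imgP[k /esym] := dp_img; have /multiplesP[l ->] := TJ k => dp.
(* As [d0] is killed by [p], so are [T d0] and [S d0]; both lie in [T U], hence in [<z>], and
   [D d0 = 0]. *)
pose d0 := d - t *+ l.
have pd0 : d0 *+ p = 0 by rewrite mulrnBl -dp mulrnAC subrr.
have zT w : w \in img T -> w *+ p = 0 -> w \in multiples z.
  by case/imgP=> u -> pw; rewrite small_commT // Tpt.
have Dd0 : D d0 = 0.
  by apply: D_eq0; rewrite zT ?img_mem ?S_img // -raddfMn pd0 raddf0.
(* Both [S] and [T] send [t] to integer multiples of [t], so they commute on it. *)
have Dt : D t = 0.
  have /imgP[u St] := S_img t; have /multiplesP[b Tu] := TJ u.
  have /multiplesP[a Tt] := TJ t; rewrite {}Tu in St.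
  apply: (addrI (T (S t))); rewrite -STE addr0 Tt St !raddfMn /= Tt St.
  by rewrite -!mulrnA; congr (_ *+ _); lia.
rewrite -Dd -[d](subrK (t *+ l)) -/d0 raddfD [D (t *+ l)]raddfMn /=.
by rewrite Dt Dd0 mul0rn addr0.
Qed.

(** For [p = 2], [t] is [q + d] up to a multiple of [z], so [D t = z]; but [D] vanishes on [T U]. *)
Lemma p_eq3 : p = 3%N.
Proof.
case: pr23 => // p2; have [m t_eq] := t_def; have [k t_T] := imgP _ _ t_img.
have: D t = z.
  rewrite t_eq /tail {1}p2 /= !raddfD /= Dq Dd [D (z *+ m)]raddfMn Dz mul0rn.
  by rewrite add0r addr0.
by rewrite t_T DT => z0; case/eqP: nz_z.
Qed.

(** * The case [p = 3]: [U] as a cyclic module over [Z[T]] *)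

Let trE u : trace u = u *+ 3 + T u *+ 3 + T (T u).
Proof. by rewrite /trace p_eq3. Qed.

Let trT (F : {additive U -> U}) u :
  (forall v, F (T v) = T (F v)) -> F (trace u) = trace (F u).
Proof. by move=> FT; rewrite !trE 2!raddfD /= ![F (_ *+ 3)]raddfMn /= !FT. Qed.

Let Tq3 : T q = d *+ 3.
Proof. by have := Tq; have := pz; rewrite p_eq3 => ->; rewrite addr0. Qed.

Let q_img : q \in img T.
Proof.
have [m t_eq] := t_def; rewrite /tail p_eq3 /= in t_eq.
have ->: q = t - z *+ m - (d *+ 3 + T d) by rewrite t_eq !addrK.
by rewrite -Tq3 !rpredB ?rpredD ?t_img ?img_mem // rpredMn ?z_img.
Qed.

Let Tt : T t = trace d.
Proof.
have [m ->] := t_def; rewrite trE /tail p_eq3 /= 2!raddfD /= Tq3 raddfD.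
by rewrite [T (z *+ m)]raddfMn Tz mul0rn addr0 [T (d *+ 3)]raddfMn addrA.
Qed.

Let U_gen3 u : exists a k, u = d *+ a + T k.
Proof.
have [a [b [k ->]]] := U_gen2 u; have /imgP[k' ->] := q_img.
by exists a, (k' *+ b + k); rewrite raddfD raddfMn addrA.
Qed.

(** Expand [u] by [U_gen3] twice: [3d = T q] is in [T^2 U] because [q] is in [T U], and the final
    remainder is already there. *)
Let mulrn3 u : u *+ 3 \in img (T \o T).
Proof.
have /imgP[q' def_q] := q_img; have [a [k ->]] := U_gen3 u.
have [b [k' ->]] := U_gen3 k; rewrite raddfD 2!mulrnDl /= [T (d *+ b)]raddfMn.
rewrite -mulrnA mulnC mulrnA -Tq3 -mulrnA mulnC mulrnA -[T d *+ 3]raddfMn -Tq3.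
by rewrite def_q; apply: rpredD; last apply: rpredD; apply: rpredMn; exact: img_TT.
Qed.

Let additive_eq0 (F : {additive U -> U}) :
  (forall u, F (T u) = T (F u)) -> F d = 0 -> forall u, F u = 0.
Proof.
move=> FT Fd u; have TB : {morph T : u v / u - v} by exact: raddfB.
suffices: F u \in img (\0 : {additive U -> U}) by case/imgP.
apply: (nilpotent_absorb TB Tn (A := fun v => exists w, v = F w)).
- by move=> _ /imgP[? ->]; rewrite raddf0 rpred0.
- move=> _ [v ->]; have [a [k ->]] := U_gen3 v.
  exists (F k); first by exists k.
  by rewrite raddfD [F (_ *+ _)]raddfMn /= Fd mul0rn add0r FT subrr rpred0.
- by exists u.
Qed.

(** The map [F] stands for a polynomial in [T]. Peeling off multiples of [d] with [U_gen3] leaves a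
    remainder [T^n v], which is zero at [n = nT]. *)
Let polyT u :
  exists2 F : {additive U -> U}, forall v, F (T v) = T (F v) & F d = u.
Proof.
suffices: forall n u, exists2 F : {additive U -> U},
    forall v, F (T v) = T (F v) & exists v, u = F d + iter n T v.
  by case/(_ nT u)=> F FT [v ->]; exists F; rewrite // Tn addr0.
elim=> [|n IHn] {}u.
  exists (\0 : {additive U -> U}) => [v|]; first by rewrite raddf0.
  by exists u; rewrite add0r.
have [a [k ->]] := U_gen3 u; have [F FT [v ->]] := IHn k.
exists (scalen a \+ (T \o F) : {additive U -> U}) => [w|] /=.
  by rewrite /scalen FT raddfD [T (_ *+ a)]raddfMn.
by exists v; rewrite raddfD addrA.
Qed.

(* Write [e = T (F d)] with [F] a polynomial in [T].  Then [S - F T^2] kills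
   [T^2 U], so [t] in [T^2 U] would give [S t = F T^2 t = trace e]. *)
Let t_notin_TT : t \notin img (T \o T).
Proof.
apply: contraNN nz_z => /imgP[k /= def_t]; have /imgP[k0 def_e] := e_img.
have [F FT Fd] := polyT k0.
pose H : {additive U -> U} := S \o T \- (F \o (T \o (T \o T))).
have HT v : H (T v) = T (H v).
  by rewrite /H /= STE DT addr0 !raddfB /= !FT.
have Hd : H d = z.
  rewrite /H /= STE Sd Dd raddfD /= Tz add0r def_e !FT Fd.
  by rewrite addrAC subrr add0r.
have TH v : T (H v) = 0.
  apply: (additive_eq0 (F := T \o H)) => [w|].
    by rewrite -[RHS]/(T (T (H w))) -HT.
  by rewrite -[LHS]/(T (H d)) Hd.
have: H (T k) = 0 by rewrite HT TH.
have ->: H (T k) = S (T (T k)) - F (T (T (T (T k)))) by [].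
rewrite -def_t S_t Tt FT trT // Fd trT // -def_e.
by rewrite addrAC subrr add0r => ->.
Qed.

(** In [t = T (a d + T k')] the coefficient [a] is prime to 3, or else [t] would lie in [T^2 U].
    Hence [T d] lies in [<t> + T^2 U]. *)
Let T_gen u : exists b k, T u = t *+ b + T (T k).
Proof.
have /imgP[k def_t] := t_img; have [a [k' def_k]] := U_gen3 k.
have p'a : ~~ (p %| a)%N.
  apply: contraNN t_notin_TT => /dvdnP[b def_a]; rewrite def_t def_k raddfD.
  rewrite rpredD ?img_TT // def_a p_eq3 mulnC mulrnA -Tq3 -raddfMn; exact: img_TT.
have Td : T d \in sump (multiples t) (img (T \o T)).
  apply: (mem_coprime_mulrn p_pr pU p'a).
  have ->: T d *+ a = t - T (T k') by rewrite def_t def_k raddfD addrK raddfMn.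
  rewrite rpredB //; last by apply: mem_sumpr; exact: img_TT.
  by apply: mem_sumpl; rewrite -[X in X \in _]mulr1n multiples_id.
have [b [v ->]] := U_gen3 u.
have: T (d *+ b + T v) \in sump (multiples t) (img (T \o T)).
  rewrite raddfD raddfMn rpredD ?rpredMn //.
  by apply: mem_sumpr; exact: img_TT.
by case/sumpP=> _ [_ [/multiplesP[b' ->] /imgP[w ->] ->]]; exists b', w.
Qed.

(** By [T_gen], [T^(m+2) u] is a multiple of [T^(m+1) t = 0] plus [T] of another element of the same
    form. *)
Let iterT0 m : iter m T t \in multiples z -> forall u, iter m.+2 T u = 0.
Proof.
move=> zt u; have TB : {morph T : u v / u - v} by exact: raddfB.
have iterD n v w : iter n T (v + w) = iter n T v + iter n T w.
  by elim: n => //= n ->; rewrite raddfD.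
have iterMn n v a : iter n T (v *+ a) = iter n T v *+ a.
  by elim: n => //= n ->; rewrite raddfMn.
suffices: iter m.+2 T u \in img (\0 : {additive U -> U}) by case/imgP.
apply: (nilpotent_absorb TB Tn (A := fun v => exists w, v = iter m.+2 T w)).
- by move=> _ /imgP[? ->]; rewrite raddf0 rpred0.
- move=> _ [v ->]; rewrite iterSr; have [b [k ->]] := T_gen v.
  exists (iter m.+2 T k); first by exists k.
  rewrite iterD iterMn -!iterSr !iterS; case/multiplesP: zt => c ->.
  by rewrite raddfMn /= Tz !mul0rn add0r subrr rpred0.
- by exists u.
Qed.

(** Take [m] minimal with [T^m t] in [<z>]. If [m] were at least 2, [small_commX] would already put
    the previous iterate in [<z>]. *)
Let Tt_z : T t \in multiples z.
Proof.
have ex_m : exists m, iter m T t \in multiples z.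
  by exists nT; rewrite Tn rpred0.
case: (ex_minnP ex_m) => -[|[|m]] // zm min_m.
  by case/multiplesP: zm => c /= ->; rewrite raddfMn /= Tz mul0rn rpred0.
have T0 := iterT0 zm; have := ltnn m.+1; rewrite (min_m m.+1) //.
have w3 : iter m.+1 T t *+ p = 0.
  rewrite p_eq3; have /imgP[k def_t] := t_img; have /imgP[k' def_k] := mulrn3 k.
  have iterMn n v a : iter n T (v *+ a) = iter n T v *+ a.
    by elim: n => //= n ->; rewrite raddfMn.
  by rewrite -iterMn def_t -raddfMn def_k -[RHS](T0 k') !iterSr.
have Dw : D (iter m.+1 T t) = 0 by rewrite iterS DT.
have TTw : T (T (iter m.+1 T t)) = 0.
  by rewrite -iterS; case/multiplesP: zm => c ->; rewrite raddfMn /= Tz mul0rn.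
apply: (small_commX p_eq3) => //; last first.
  by rewrite trE -p_eq3 w3 add0r -raddfMn w3 raddf0 add0r TTw raddf0.
(* Since [T t = trace d], every later iterate has the form [T (trace v)] with [v] an iterate of [T]
   on [d]. *)
case: m {zm min_m T0 w3 Dw TTw} => [|m]; [by left | right; exists (iter m T d)].
rewrite -[iter m.+2 T t]/(T (T (iter m T t))) -iterS iterSr Tt.
by congr (T _); elim: m => //= m ->; rewrite trT.
Qed.

Lemma module_contradiction : False.
Proof.
have T3 u : T (T (T u)) = 0 by apply: (iterT0 (m := 1) Tt_z).
have /multiplesP[a TTd] : T (T d) \in multiples z.
  have [b [k ->]] := T_gen d; rewrite raddfD T3 addr0 raddfMn.
  by rewrite rpredMn ?Tt_z.
have /imgP[k0 def_e] := e_img.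
have STd : S (T d) = z.
  by rewrite STE Sd Dd raddfD /= Tz def_e T3 addr0 add0r.
have /multiplesP[b Sdz] : S d \in multiples z.
  rewrite Sd def_e rpredD //; first by rewrite -[X in X \in _]mulr1n multiples_id.
  have [b [k ->]] := T_gen k0; rewrite raddfD T3 addr0 raddfMn.
  by rewrite rpredMn ?Tt_z.
pose Y v := v + S v.
have Sz0 n : S (z *+ n) = 0 by rewrite raddfMn /= Sz mul0rn.
have iterY i v c : S v = z *+ c -> iter i Y v = v + z *+ (c * i).
  move=> Sv; elim: i => [|i /= ->]; first by rewrite muln0 addr0.
  by rewrite /Y raddfD /= Sz0 addr0 Sv addrAC -addrA -mulrnDr mulnS.
(* The element [x y^i] moves [w] by [(a + i) z], which is [3a z = 0] for [i = 2a]. *)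
pose i := (2 * a)%N; pose w := T d + z *+ (b.+1 * i).
have gd : iter i Y (d + T d) - d = w.
  rewrite (@iterY _ _ b.+1); first by rewrite -[d + _ + _]addrA [d + _]addrC addrK.
  by rewrite raddfD /= Sdz STd mulrSr.
have Tw : T w = z *+ a.
  by rewrite raddfD /= TTd [T (z *+ _)]raddfMn /= Tz mul0rn addr0.
have gw : iter i Y (w + T w) = w.
  rewrite (@iterY _ _ 1%N); last by rewrite Tw !raddfD /= !Sz0 !addr0 STd.
  rewrite Tw -addrA -mulrnDr mul1n /i -mulSn -p_eq3.
  by rewrite mulrnA pz mul0rn addr0.
have pw : w *+ p = 0.
  rewrite mulrnDl [z *+ _ *+ p]mulrnAC pz mul0rn addr0 p_eq3.
  by rewrite -raddfMn; have /imgP[k /= ->] := mulrn3 d.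
have := @small_comm i d; rewrite /= -/Y gd => /(_ pw gw) zw.
(* Then [T d] differs from [w] by a multiple of [z], so [S] kills it, against [S (T d) = z]. *)
have /multiplesP[c def_Td] : T d \in multiples z.
  by rewrite -[T d](addrK (z *+ (b.+1 * i))) rpredB ?multiples_id.
by case/eqP: nz_z; rewrite -STd def_Td Sz0.
Qed.

End Module.

(** * Derived subgroups forming a chain *)

Import FiniteModule.
Local Close Scope ring_scope.
Local Open Scope group_scope.

Section DerivedChains.
Variable gT : finGroupType.
Implicit Types (G H K N M : {group gT}) (x y g h u v : gT).

Lemma der1_joing_cycles_sub N g h :
  g \in 'N(N) -> h \in 'N(N) -> [~ g, h] \in N ->
  (<[g]> <*> <[h]>)^`(1) \subset N.
Proof.
move=> Ng Nh Ngh.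
have nNgh : <[g]> <*> <[h]> \subset 'N(N).
  by rewrite join_subG !cycle_subG Ng.
apply: der1_min => //.
rewrite quotientY ?cycle_subG // !quotient_cycle // abelianY !cycle_abelian /=.
rewrite cent_cycle cycle_subG cent1C; apply/cent1P/commgP.
by rewrite -morphR //= coset_id.
Qed.

Lemma mem_joing_cycles g h :
  g \in <[g]> <*> <[h]> /\ h \in <[g]> <*> <[h]>.
Proof. by split; rewrite mem_gen // inE cycle_id ?orbT. Qed.

Lemma mem_der1_cycles g h : [~ g, h] \in (<[g]> <*> <[h]>)^`(1).
Proof. by have [? ?] := mem_joing_cycles g h; apply: mem_commg. Qed.

(** The working form of the chain condition: [N1] contains [<g, h>'] but not [<u, v>'], so [<g, h>']
    lies in [<u, v>'], hence in [N2]. *)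
Lemma DC_comm G N1 N2 g h u v :
    DC_group G -> [/\ g \in G, h \in G, u \in G & v \in G] ->
    [/\ g \in 'N(N1), h \in 'N(N1), [~ g, h] \in N1 & [~ u, v] \notin N1] ->
    [/\ u \in 'N(N2), v \in 'N(N2) & [~ u, v] \in N2] ->
  [~ g, h] \in N2.
Proof.
move=> dcG [Gg Gh Gu Gv] [N1g N1h N1gh N1'uv] [N2u N2v N2uv].
have sG a b : a \in G -> b \in G -> <[a]> <*> <[b]> \subset G.
  by move=> Ga Gb; rewrite join_subG !cycle_subG Ga.
have [sd | sd] := dcG [group of <[u]> <*> <[v]>] [group of <[g]> <*> <[h]>]
  (sG _ _ Gu Gv) (sG _ _ Gg Gh).
  case/negP: N1'uv; apply: (subsetP (der1_joing_cycles_sub N1g N1h N1gh)).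
  exact: (subsetP sd _ (mem_der1_cycles u v)).
apply: (subsetP (der1_joing_cycles_sub N2u N2v N2uv)).
exact: (subsetP sd _ (mem_der1_cycles g h)).
Qed.

(** Both generators normalize [<c>M], as [c^x = c [c, x]] and [c^y = c [c, y]]. *)
Lemma der1_joing_cycles_mod M x y (c := [~ x, y]) :
    x \in 'N(M) -> y \in 'N(M) -> [~ c, x] \in M -> [~ c, y] \in M ->
  (<[x]> <*> <[y]>)^`(1) \subset <[c]> * M.
Proof.
move=> Mx My Mcx Mcy; have Mc : c \in 'N(M) by rewrite groupR.
rewrite -norm_joinEl ?cycle_subG //.
have cP : c \in <[c]> <*> M by rewrite mem_gen // inE cycle_id.
have MP m : m \in M -> m \in <[c]> <*> M by move=> Mm; rewrite mem_gen // inE Mm orbT.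
have nP g : g \in 'N(M) -> [~ c, g] \in M -> g \in 'N(<[c]> <*> M).
  move=> Mg Mcg; rewrite inE -genJ gen_subG conjUg subUset.
  rewrite -cycleJ cycle_subG conjg_mulR groupM ?(MP _ Mcg) //=.
  by rewrite (normP Mg); apply/subsetP=> m; apply: MP.
exact: (@der1_joing_cycles_sub [group of <[c]> <*> M] x y
  (nP _ Mx Mcx) (nP _ My Mcy) cP).
Qed.

Lemma DC_group_sub G H : H \subset G -> DC_group G -> DC_group H.
Proof.
move=> sHG dcG A B sA sB.
by apply: dcG; [apply: subset_trans sA sHG | apply: subset_trans sB sHG].
Qed.

(** For a pair whose derived subgroup has maximal order, the chain condition makes it contain every
    [<a, b>']. *)
Lemma DC_der1_cycles G : DC_group G ->
  exists x y, [/\ x \in G, y \in G & G^`(1) = (<[x]> <*> <[y]>)^`(1)].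
Proof.
move=> dcG; pose f (a : gT * gT) := #|(<[a.1]> <*> <[a.2]>)^`(1)|.
have G11 : (1, 1) \in setX G G by rewrite inE !group1.
have [[x y] /setXP[/= Gx Gy] max_xy] := arg_maxnP f G11.
have sG a b : a \in G -> b \in G -> <[a]> <*> <[b]> \subset G.
  by move=> Ga Gb; rewrite join_subG !cycle_subG Ga.
exists x, y; split=> //; apply/eqP; rewrite eqEsubset andbC.
apply/andP; split; first by rewrite dergS ?sG.
rewrite gen_subG; apply/subsetP=> _ /imset2P[a b Ga Gb ->].
apply: subsetP (mem_der1_cycles a b).
have [//|sd] := dcG [group of <[a]> <*> <[b]>] [group of <[x]> <*> <[y]>]
  (sG _ _ Ga Gb) (sG _ _ Gx Gy).
have Gab : (a, b) \in setX G G by apply/setXP.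
have /eqP <-: (<[x]> <*> <[y]>)^`(1) == (<[a]> <*> <[b]>)^`(1).
  by rewrite eqEcard sd; apply: (max_xy (a, b)).
exact: subxx.
Qed.

End DerivedChains.

Lemma DC_group_quotient (gT : finGroupType) (G N : {group gT}) :
  N <| G -> DC_group G -> DC_group (G / N)%G.
Proof.
move=> nNG dcG A B sA sB.
have [A1 defA _ sA1] := inv_quotientS nNG sA.
have [B1 defB _ sB1] := inv_quotientS nNG sB.
have nN (C : {set gT}) : C \subset G -> C \subset 'N(N).
  by move=> sC; apply: (subset_trans sC (normal_norm nNG)).
rewrite defA defB -!quotient_der ?nN //.
by have [sd | sd] := dcG A1 B1 sA1 sB1; [left | right]; apply: quotientS.
Qed.

(* Locked so that additivity rewrites do not unfold it. *)
HB.lock Definition fmod_comm (gT : finGroupType) (K : {group gT})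
  (abK : abelian K) (g : gT) (u : fmod_of abK) : fmod_of abK :=
  (actr u g - u)%R.

(** * An abelian subgroup as a module for its normalizer *)

Section ModuleOfDC.
Variables (gT : finGroupType) (K : {group gT}) (abK : abelian K).
Local Notation U := (fmod_of abK).
Local Open Scope ring_scope.

Local Notation fmod_comm := (@fmod_comm gT K abK).

Lemma fmod_comm_is_zmod_morphism g : zmod_morphism (fmod_comm g).
Proof.
by move=> u v; rewrite !unlock actAr actNr !opprD !opprK addrACA.
Qed.
HB.instance Definition _ g :=
  GRing.isZmodMorphism.Build U U (fmod_comm g) (fmod_comm_is_zmod_morphism g).

Lemma actr_comm g u : actr u g = u + fmod_comm g u.
Proof. by rewrite unlock addrC subrK. Qed.

Lemma fmval_comm g u : g \in 'N(K)%g -> fmval (fmod_comm g u) = [~ fmval u, g]%g.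
Proof.
move=> Kg; rewrite commgEl -(fmvalJ _ Kg) unlock [_ - _]addrC.
by [].
Qed.

Lemma fmod_commE g k :
  g \in 'N(K)%g -> k \in K -> fmod_comm g (fmod abK k) = fmod abK [~ k, g]%g.
Proof.
move=> Kg Kk; have Kkg : [~ k, g]%g \in K by rewrite groupM ?groupV ?memJ_norm.
by apply: fmod_inj; rewrite fmval_comm // !fmodK.
Qed.

(** Carries additive subgroups back into [K], where derived subgroups can be compared with them. *)
Lemma fgroup_set (J : zmodClosed U) : group_set [set fmval u | u in J].
Proof.
apply/group_setP; split=> [|_ _ /imsetP[u Ju ->] /imsetP[v Jv ->]].
  by apply/imsetP; exists 0; rewrite ?rpred0.
by apply/imsetP; exists (u + v); rewrite ?rpredD.
Qed.
Canonical fgroup (J : zmodClosed U) := Group (fgroup_set J).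

Lemma mem_fgroup (J : zmodClosed U) u : (fmval u \in fgroup J) = (u \in J).
Proof.
by apply/imsetP/idP => [[v Jv /fmod_inj->] | Ju] //; exists u.
Qed.

Lemma mem_fgroup_fmod (J : zmodClosed U) k :
  k \in K -> (k \in fgroup J) = (fmod abK k \in J).
Proof. by move=> Kk; rewrite -mem_fgroup fmodK. Qed.

Lemma norm_fgroup (J : zmodClosed U) g :
  g \in 'N(K)%g -> {in J, forall u, fmod_comm g u \in J} ->
  g \in 'N(fgroup J)%g.
Proof.
move=> Kg Jg; rewrite inE; apply/subsetP=> _ /imsetP[_ /imsetP[u Ju ->] ->].
rewrite -[(_ ^ _)%g]fmvalJ // mem_fgroup actr_comm rpredD //; exact: Jg.
Qed.

Lemma card_fmod : #|{: U}| = #|K|.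
Proof.
rewrite -(card_imset predT (@fmod_inj _ _ abK)); apply: eq_card => k.
apply/imsetP/idP => [[u _ ->] | Kk]; first exact: fmodP.
by exists (fmod abK k); rewrite ?fmodK.
Qed.

Lemma iter_fmod_comm (G : {group gT}) g u n :
    K \subset G -> G \subset 'N(K)%g -> g \in G ->
  fmval (iter n (fmod_comm g) u) \in 'L_n.+1(G)%g.
Proof.
move=> sKG nKG Gg; elim: n => [|n IHn]; first exact: (subsetP sKG) (fmodP u).
by rewrite iterS fmval_comm ?(subsetP nKG) // lcnSn mem_commg.
Qed.

End ModuleOfDC.

(** * The two-generator case *)

Section TwoGenerated.
Variables (gT : finGroupType) (G N : {group gT}) (p : nat) (x y : gT).
Local Notation c := [~ x, y].
Local Notation d := [~ c, x].
Local Notation e := [~ c, y].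
Local Notation z := [~ d, c].

Hypotheses (p_pr : prime p) (p_le3 : p <= 3) (pG : p.-group G).
Hypotheses (dcG : DC_group G) (defG : G = <[x]> <*> <[y]> :> {set gT}).
Hypotheses (nNG : N <| G) (abN : abelian N) (sNG' : N \subset G^`(1)).
Hypotheses (Nd : d \in N) (Ne : e \in N).
Hypotheses (nz_z : z != 1) (cze : [~ e, c] = 1).
Hypotheses (sG2z : G^`(2) \subset <[z]>) (Zz : z \in 'Z(G)) (pz : z ^+ p = 1).

Let Gx : x \in G. Proof. by rewrite defG; case: (mem_joing_cycles x y). Qed.
Let Gy : y \in G. Proof. by rewrite defG; case: (mem_joing_cycles x y). Qed.
Let G'c : c \in G^`(1). Proof. exact: mem_commg. Qed.
Let Gc : c \in G. Proof. by rewrite groupR. Qed.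
Let nN g : g \in G -> g \in 'N(N). Proof. exact: subsetP (normal_norm nNG) g. Qed.
Let sG'cN : G^`(1) \subset <[c]> * N.
Proof. by rewrite defG; apply: der1_joing_cycles_mod; rewrite ?nN. Qed.

(** This enlarges [N] so as to contain [q] and [t], and it is still abelian because it lies in
    [<q>N]. *)
Let K := 'C_(G^`(1))(N)%G.

Let nKG : K <| G.
Proof.
rewrite /normal subIset ?der_sub //= normsI ?gFnorm //.
exact: norms_cent (normal_norm nNG).
Qed.
Let nK g : g \in G -> g \in 'N(K). Proof. exact: subsetP (normal_norm nKG) g. Qed.
Let sKG' : K \subset G^`(1). Proof. exact: subsetIl. Qed.
Let sKG : K \subset G. Proof. exact: normal_sub. Qed.
Let sNK : N \subset K. Proof. by rewrite subsetI sNG'. Qed.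

Let K'c : c \notin K.
Proof.
apply: contraNN nz_z => /setIP[_ cNc].
by apply/commgP/commute_sym/(centP cNc).
Qed.

Let zcent g : g \in G -> commute z g.
Proof. by move=> Gg; case/centerP: Zz => _; apply. Qed.

Let G2c u : u \in K -> [~ u, c] \in <[z]>.
Proof.
by move=> Ku; apply: (subsetP sG2z); rewrite mem_commg // (subsetP sKG').
Qed.

Let zcyc_cent u g : u \in <[z]> -> g \in G -> commute u g.
Proof.
by case/cycleP=> i -> Gg; apply/commute_sym/commuteX/commute_sym/zcent.
Qed.

Let q := c ^+ p.

Let Kq : q \in K.
Proof.
rewrite inE groupX //=; apply/centP=> n Nn; apply/commute_sym/commgP.
have Kn := subsetP sNK n Nn; have zn := G2c Kn.
rewrite commgX; last by apply/commute_sym/zcyc_cent.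
by case/cycleP: zn => i ->; rewrite -expgM mulnC expgM pz expg1n.
Qed.

(** For [i] prime to [p], [c^i] generates [<c>], and [c] is not in [K]. *)
Let dvd_p i : c ^+ i \in K -> p %| i.
Proof.
move=> Kci; apply: contraNT K'c => p'i.
have co_i : coprime #[c] i.
  have /p_natP[n ->] : p.-nat #[c] by apply: mem_p_elt pG _.
  by rewrite coprimeXl // prime_coprime.
rewrite -cycle_subG; have: generator <[c]> (c ^+ i) by rewrite generator_coprime.
by move/eqP->; rewrite cycle_subG.
Qed.

Let K_gen (M : {group gT}) k :
  G^`(1) \subset <[c]> * M -> M \subset K -> k \in K ->
  exists j, exists2 m, m \in M & k = q ^+ j * m.
Proof.
move=> sG'M sMK Kk.
have /mulsgP[_ m /cycleP[i ->] Mm def_k] := subsetP sG'M k (subsetP sKG' k Kk).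
have Kci : c ^+ i \in K.
  by rewrite -[_ ^+ i](mulgK m) -def_k groupM ?groupV ?(subsetP sMK m).
have /dvdnP[j def_i] := dvd_p Kci.
by exists j, m; rewrite // def_k def_i mulnC expgM.
Qed.

Let abK : abelian K.
Proof.
have cNq : q \in 'C(N) by case/setIP: Kq.
have sKqN : K \subset <[q]> * N.
  apply/subsetP=> k Kk; have [j [m Nm ->]] := K_gen sG'cN sNK Kk.
  by rewrite mem_mulg ?mem_cycle.
apply: abelianS sKqN _; rewrite abelianM abN cycle_abelian /=.
by rewrite centsC cycle_subG.
Qed.

(** Conjugation by [g] fixes the central element [[k, c]], and the factor [[c, g]] of [c^g] commutes
    with [K]. This is why [D] kills the images of [T] and [S]. *)
Let comm_conj_c g k : g \in G -> [~ c, g] \in N -> k \in K ->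
  [~ k ^ g, c] = [~ k, c].
Proof.
move=> Gg Ncg Kk; have zk := G2c Kk.
have Kkg : k ^ g \in K by rewrite memJ_norm ?nK.
have kg_c : commute (k ^ g) [~ c, g].
  by apply: (centsP abK) => //; apply: (subsetP sNK).
have zkg := G2c Kkg.
have: [~ k, c] ^ g = [~ k, c] by rewrite conjgE (zcyc_cent zk) // mulKg.
rewrite conjRg [c ^ g]conjg_mulR commgMJ.
rewrite (eqP (introT commgP kg_c)) mul1g => <-.
by rewrite [RHS]conjgE (zcyc_cent zkg) ?mulKg // groupR.
Qed.

Local Notation U := (fmod_of abK).
Local Notation "k %:U" := (fmod abK k) (at level 2, format "k %:U").
Local Notation T := (fmod_comm (abK := abK) x : {additive U -> U}).
Local Notation S := (fmod_comm (abK := abK) y : {additive U -> U}).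
Local Notation D := (fmod_comm (abK := abK) c : {additive U -> U}).

Let Kd : d \in K. Proof. exact: (subsetP sNK). Qed.
Let Ke : e \in K. Proof. exact: (subsetP sNK). Qed.
Let Kz : z \in K.
Proof. by rewrite groupM ?groupV // memJ_norm ?nK. Qed.
Let Kcomm g k : g \in G -> k \in K -> [~ k, g] \in K.
Proof. by move=> Gg Kk; rewrite groupM ?groupV ?memJ_norm ?nK. Qed.

Let mem_cycleU k u : k \in K -> (fmval u \in <[k]>) = (u \in multiples k%:U).
Proof.
move=> Kk; apply/cycleP/multiplesP=> -[i def_u]; exists i.
  by apply: fmod_inj; rewrite def_u -fmodX ?fmodK ?groupX.
by rewrite def_u -fmodX ?fmodK ?groupX.
Qed.

Let D_z (u : U) : D u \in multiples z%:U.
Proof. by rewrite -mem_cycleU // fmval_comm ?nK // G2c ?fmodP. Qed.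

Let D_act g (u : U) : g \in G -> [~ c, g] \in N -> D (actr u g) = D u.
Proof.
move=> Gg Ncg; apply: fmod_inj; rewrite !fmval_comm ?nK // fmvalJ ?nK //.
by rewrite comm_conj_c ?fmodP.
Qed.

Let D_comm g (u : U) : g \in G -> [~ c, g] \in N -> D (fmod_comm g u) = 0%R.
Proof.
move=> Gg Ncg; apply: (addrI (D u)).
by rewrite -raddfD -actr_comm D_act // addr0.
Qed.

Let z_comm g : g \in G -> fmod_comm g z%:U = 0%R.
Proof.
move=> Gg; rewrite /= fmod_commE ?nK //.
by rewrite (eqP (introT commgP (zcent Gg))) fmod1.
Qed.

(** Compares the actions of [x y] and [y x c] on [K]; [Sd] compares their actions on [c]. *)
Let STE (u : U) : S (T u) = (T (S u) + D u)%R.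
Proof.
have: actr (actr u x) y = actr (actr (actr u y) x) c.
  rewrite -(actrM (nK Gx) (nK Gy)) -(actrM (nK Gy) (nK Gx)).
  by rewrite -(actrM (nK (groupM Gy Gx)) (nK Gc)) -commgC.
rewrite [RHS]actr_comm !D_act // !actr_comm.
rewrite !raddfD /= => E.
apply: (addrI (u + T u + S u)%R); rewrite -addrA [LHS]E.
by rewrite !addrA [(u + fmod_comm y u + _)%R]addrAC.
Qed.

Let x_c : c ^ x = c * d. Proof. by rewrite conjg_mulR. Qed.
Let y_c : c ^ y = c * e. Proof. by rewrite conjg_mulR. Qed.
Let c_K k : k \in K -> k ^ c = k * [~ k, c]. Proof. by rewrite conjg_mulR. Qed.

Let fM k k' : k \in K -> k' \in K -> (k * k')%:U = (k%:U + k'%:U)%R.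
Proof. exact: fmodM. Qed.

Let Sd : S d%:U = (z%:U + T e%:U)%R.
Proof.
have: c ^ (x * y) = c ^ (y * x * c) by rewrite [x * y]commgC.
rewrite (conjgM _ x y) (conjgM _ (y * x) c) (conjgM _ y x) x_c y_c.
rewrite (conjMg c d) (conjMg c e) y_c x_c (conjMg (c * d)) (conjMg c d c).
rewrite (conjgE c c) mulKg -(mulgA c e) -(mulgA c (d ^ c)) => /mulgI.
have Kex : e ^ x \in K by rewrite memJ_norm ?nK.
have Kdy : d ^ y \in K by rewrite memJ_norm ?nK.
rewrite (c_K Kd) (c_K Kex) comm_conj_c // cze mulg1 => /(congr1 (fmod abK)).
rewrite (fM Ke Kdy) (fM (groupM Kd Kz) Kex) (fM Kd Kz).
rewrite (fmodJ abK d (nK Gy)) (fmodJ abK e (nK Gx)) !actr_comm => E.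
apply: (addrI (e%:U + d%:U)%R); rewrite -addrA E.
rewrite [(e%:U + d%:U)%R]addrC !addrA; congr (_ + _)%R.
by rewrite addrAC.
Qed.

Let Sq : S q%:U = (e%:U *+ p)%R.
Proof.
rewrite /= fmod_commE ?nK // -fmodX //; congr (fmod _ _).
rewrite commgEl conjXg y_c expgMn ?mulKg //.
by apply/commute_sym/commgP/eqP.
Qed.

Let Tq : T q%:U = (d%:U *+ p + z%:U *+ 'C(p, 2))%R.
Proof.
rewrite /= fmod_commE ?nK // -!fmodX // -fmodM ?groupX //; congr (fmod _ _).
rewrite commgEl conjXg x_c expMg_Rmul -?mulgA ?mulKg //.
  exact/commute_sym/zcent/(subsetP (der_sub 1 G))/(subsetP sKG').
exact/commute_sym/zcent.
Qed.

Let Dq : D q%:U = 0%R.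
Proof.
rewrite /= fmod_commE ?nK // (eqP (introT commgP _)) ?fmod1 //.
exact/commute_sym/commuteX.
Qed.

Let De : D e%:U = 0%R.
Proof. by rewrite /= fmod_commE ?nK // cze fmod1. Qed.

Let Dd : D d%:U = z%:U.
Proof. by rewrite /= fmod_commE ?nK. Qed.

Let pU : p.-nat #|{: U}|.
Proof. by rewrite card_fmod; apply: pgroupS pG. Qed.

Let nil_comm g : g \in G -> forall u : U, iter (nil_class G) (fmod_comm g) u = 0%R.
Proof.
move=> Gg u; apply: fmod_inj; apply/set1P.
have := iter_fmod_comm u (nil_class G) sKG (normal_norm nKG) Gg.
by rewrite ((lcn_nil_classP _ (pgroup_nil pG)) (leqnn _)).
Qed.

Let act_xyi i (u : U) :
  iter i (fun v => v + S v)%R (u + T u)%R = actr u (x * y ^+ i).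
Proof.
elim: i => [|i IHi] /=; first by rewrite mulg1 actr_comm.
rewrite IHi expgSr mulgA (actrM (nK (groupM Gx (groupX i Gy))) (nK Gy)).
by rewrite [RHS]actr_comm.
Qed.

Let pr23 : p = 2 \/ p = 3.
Proof. by case: p p_pr p_le3 => [|[|[|[|]]]] //; [left | right]. Qed.

Let comm_xp (u : U) : fmod_comm (x ^+ p) u = T (trace p T u).
Proof.
apply: (addrI u); rewrite -actr_comm /trace.
have x2 (v : U) : actr v (x ^+ 2) = (v + (T v *+ 2 + T (T v)))%R.
  rewrite (actrM (nK Gx) (nK Gx)) [actr v x]actr_comm actr_comm raddfD /=.
  by rewrite mulr2n !addrA.
case: pr23 => -> /=; first by rewrite x2 raddfD [T (_ *+ 2)%R]raddfMn.
rewrite expgS (actrM (nK Gx) (nK (groupX 2 Gx))) x2 [actr u x]actr_comm.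
rewrite -mulrnDl (raddfD T (_ *+ 3)%R) /= [fmod_comm x (_ *+ 3)%R](raddfMn T).
rewrite !(raddfD T u) /= (raddfD T (T u)) /= !mulrnDl (mulrS _ 2).
by rewrite (mulrS (fmod_comm x (fmod_comm x u)) 2) -!addrA;
  congr (_ + (_ + (_ + _)))%R.
Qed.

Let t := [~ x ^+ p, y].

Let tE : exists2 m, t \in K & t%:U = (q%:U + tail p T d%:U + z%:U *+ m)%R.
Proof.
have Kdx : d ^ x \in K by rewrite memJ_norm ?nK.
have cz k : k \in K -> k * c = c * (k * [~ k, c]).
  by move=> Kk; rewrite [RHS]mulgA -commgC.
have t2 : [~ x ^+ 2, y] = c ^+ 2 * (d * z).
  by rewrite commMgJ x_c -mulgA cz // mulgA.
have Kz2 : d * z \in K by rewrite groupM.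
have cdx : [~ d ^ x, c] = z by rewrite comm_conj_c.
rewrite /tail; case: pr23 => p_eq; rewrite p_eq /=.
  have {}t2 : t = q * (d * z) by rewrite /t /q p_eq.
  exists 1%N; rewrite t2; first by rewrite groupM.
  by rewrite (fM Kq Kz2) (fM Kd Kz) addrA.
pose a := d * d ^ x; have Ka : a \in K by rewrite groupM.
have t3 : t = q * (a ^ (c ^+ 2) * (d * z)).
  rewrite /t /q p_eq (expgS x 2) commMgJ t2 (conjgM c x x) x_c (conjMg c d x) x_c.
  rewrite -(mulgA c d (d ^ x)) -/a (mulgA (c * a)) -(mulgA c a) (conjgC a).
  by rewrite (expgS c 2) -(mulgA c) -(mulgA (c ^+ 2)) -(mulgA c (c ^+ 2)).
have Kac : a ^ (c ^+ 2) \in K by rewrite memJ_norm ?nK ?groupX.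
have Kacz : a ^ (c ^+ 2) * (d * z) \in K by rewrite groupM.
(* Conjugation by [c^2] adds [2 D a = 4z] to [a], and [[x^2, y] = c^2 d z] contributes one more
   [z]. *)
exists 5%N; first by rewrite t3 groupM.
have aU : a%:U = (d%:U + (d%:U + T d%:U))%R.
  by rewrite (fM Kd Kdx) (fmodJ abK d (nK Gx)) actr_comm.
have Da : fmod_comm c a%:U = (z%:U *+ 2)%R.
  by rewrite aU !(raddfD D) /= Dd D_comm // addr0.
have zcU : fmod_comm c (z%:U *+ 2)%R = 0%R.
  by rewrite (raddfMn D) /= z_comm // mul0rn.
have ->: t%:U = (q%:U + ((a%:U + z%:U *+ 4) + (d%:U + z%:U)))%R.
  rewrite t3 (fM Kq Kacz) (fM Kac Kz2) (fM Kd Kz); congr (_ + (_ + _))%R.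
  rewrite (fmodJ abK a (nK (groupX 2 Gc))) (actrM (nK Gc) (nK Gc)).
  by rewrite !actr_comm (raddfD D) /= Da zcU addr0 -addrA -mulrnDr.
rewrite aU (mulrS d%:U 2) (mulrSr z%:U 4) mulr2n -!addrA.
by congr (_ + (_ + (_ + _)))%R; rewrite !(addrCA _ d%:U).
Qed.

Let Kt : t \in K. Proof. by case: tE. Qed.

Let pzU : (z%:U *+ p = 0)%R.
Proof. by rewrite -fmodX // pz fmod1. Qed.

Let nz_zU : z%:U != 0%R :> U.
Proof.
apply: contraNneq nz_z => z0; rewrite -(fmodK abK Kz) [fmod _ _]z0.
by rewrite /= fmval0.
Qed.

(** Since [e = [c, y]] is central in [G'] and [d = [c, x]] is not, [<c, y>'] lies in [<c, x>'],
    which lies in [J]; the multiples of [z] make [J] normalized by [c]. *)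
Let e_gen : exists a b k, (e%:U = d%:U *+ a + z%:U *+ b + T k)%R.
Proof.
pose J : zmodClosed U := sump (sump (multiples d%:U) (multiples z%:U)) (img T).
suffices: e \in fgroup J.
  rewrite mem_fgroup_fmod // => /sumpP[v [_ [sv /imgP[k ->] ->]]].
  have [_ [_ [/multiplesP[a ->] /multiplesP[b ->] ->]]] := sumpP _ _ _ sv.
  by exists a, b, k.
have zJ u : u \in multiples z%:U -> u \in J.
  by move=> zu; apply: mem_sumpl; apply: mem_sumpr.
have Zc_norm g : g \in G -> g \in 'N('Z(G^`(1))).
  exact: subsetP (char_norm_trans (center_char _) (der_norm 1 G)) g.
apply: (DC_comm dcG (N1 := 'Z(G^`(1))%G) (u := c) (v := x)); split=> //.
- exact: Zc_norm.
- exact: Zc_norm.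
- rewrite inE (subsetP sKG') //; apply/centP=> g /(subsetP sG'cN).
  case/mulsgP=> _ m /cycleP[i ->] Nm ->; apply: commuteM.
    exact/commuteX/commgP/eqP.
  by apply: (centsP abN).
- apply: contraNN nz_z => /centerP[_ /(_ c G'c)] cdc.
  exact/commgP.
- apply: norm_fgroup => [|u _]; first exact: nK.
  exact/zJ/D_z.
- by apply: norm_fgroup => [|u _]; [exact: nK | apply: mem_sumpr (img_mem T u)].
- rewrite mem_fgroup_fmod //; apply: mem_sumpl; apply: mem_sumpl.
  by rewrite -[d%:U]mulr1n multiples_id.
Qed.

(** The sums on the right form a subgroup [J] with [G'] inside [<c>J]; by [K_gen], the [c]-part of
    an element of [K] is a power of [q]. *)
Let U_gen (u : U) : exists a b b' k k',
  u = (d%:U *+ a + q%:U *+ b + e%:U *+ b' + T k + S k')%R.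
Proof.
pose J0 : zmodClosed U :=
  sump (sump (multiples d%:U) (multiples q%:U)) (multiples e%:U).
pose J : zmodClosed U := sump (sump J0 (img T)) (img S).
have dJ : d%:U \in J.
  do 4!apply: mem_sumpl; by rewrite -[d%:U]mulr1n multiples_id.
have eJ : e%:U \in J.
  do 2!apply: mem_sumpl; apply: mem_sumpr; by rewrite -[e%:U]mulr1n multiples_id.
have qJ : q%:U \in J.
  do 3!apply: mem_sumpl; apply: mem_sumpr; by rewrite -[q%:U]mulr1n multiples_id.
have TJ v : T v \in J by apply: mem_sumpl; apply: mem_sumpr; apply: img_mem.
have SJ v : S v \in J by apply: mem_sumpr; apply: img_mem.
have sG'J : G^`(1) \subset <[c]> * fgroup J.
  rewrite defG; apply: (@der1_joing_cycles_mod _ [group of fgroup J] x y).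
  - by apply: norm_fgroup => [|v _]; [apply: nK | apply: TJ].
  - by apply: norm_fgroup => [|v _]; [apply: nK | apply: SJ].
  - by rewrite mem_fgroup_fmod.
  - by rewrite mem_fgroup_fmod.
have sJK : fgroup J \subset K by apply/subsetP=> _ /imsetP[v _ ->]; apply: fmodP.
have [j [m Jm def_u]] := K_gen sG'J sJK (fmodP u).
have Km : m \in K by apply: (subsetP sJK).
have {Jm} : u \in J.
  have -> : u = (q%:U *+ j + m%:U)%R.
    apply: fmod_inj; rewrite [LHS]def_u -fmodX // -(fM (groupX j Kq) Km) fmodK //.
    exact: (groupM (groupX j Kq) Km).
  by rewrite rpredD ?rpredMn // -mem_fgroup_fmod.
case/sumpP=> v1 [_ [sv1 /imgP[k' ->] ->]].
have [v2 [_ [sv2 /imgP[k ->] ->]]] := sumpP _ _ _ sv1.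
have [v3 [_ [sv3 /multiplesP[b' ->] ->]]] := sumpP _ _ _ sv2.
have [_ [_ [/multiplesP[a ->] /multiplesP[b ->] ->]]] := sumpP _ _ _ sv3.
by exists a, b, b', k, k'.
Qed.

Let norm_cyclez g : g \in G -> g \in 'N(<[z]>).
Proof.
move=> Gg; apply: (subsetP (cent_sub _)); rewrite cent_cycle.
exact/cent1P/commute_sym/zcent.
Qed.

Let ord_z : #[z] = p.
Proof. exact/nt_prime_order. Qed.

(** If [z] is in [<w>], the two cyclic groups of order [p] coincide. Otherwise [<d, c>'] is not
    inside [<w>], and the chain condition puts [w] in [<z>]. *)
Let small_commG g h : g \in G -> h \in G -> commute [~ g, h] g ->
  commute [~ g, h] h -> [~ g, h] ^+ p = 1 -> [~ g, h] \in <[z]>.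
Proof.
move=> Gg Gh cg ch pw; set w := [~ g, h] in cg ch pw *.
have [-> | nz_w] := eqVneq w 1; first exact: group1.
have ord_w : #[w] = p by apply/nt_prime_order.
have [zw | w'z] := boolP (z \in <[w]>).
  suffices ->: <[z]> = <[w]> by apply: cycle_id.
  by apply/eqP; rewrite eqEcard cycle_subG zw -!orderE ord_z ord_w /=.
have Nw a : commute w a -> a \in 'N(<[w]>).
  move=> cwa; apply: (subsetP (cent_sub _)); rewrite cent_cycle.
  exact/cent1P/commute_sym.
have Gd : d \in G by apply: (subsetP sKG).
apply: (DC_comm dcG (N1 := <[w]>%G) (u := d) (v := c)); split=> //;
  rewrite ?Nw ?cycle_id ?norm_cyclez //.
Qed.

Let small_comm i (k : U) :
  let g u := iter i (fun v => v + S v)%R (u + T u)%R in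
  let w := (g k - k)%R in (w *+ p = 0)%R -> g w = w -> w \in multiples z%:U.
Proof.
move=> g w; pose h := x * y ^+ i.
have Gh : h \in G by rewrite groupM ?groupX.
have -> : w = fmod_comm h k by rewrite /w /g act_xyi actr_comm [(k + _)%R]addrC addrK.
rewrite /g act_xyi -mem_cycleU // fmval_comm ?nK // => pw hw.
have Kw : [~ fmval k, h] \in K by rewrite Kcomm ?fmodP.
apply: small_commG => //; first by rewrite (subsetP sKG) ?fmodP.
- by apply: (centsP abK); rewrite ?fmodP.
- have Ew : [~ fmval k, h] ^ h = [~ fmval k, h].
    by rewrite -(fmval_comm k (nK Gh)) -[LHS](fmvalJ _ (nK Gh)) hw.
  by rewrite /commute conjgC Ew.
- by rewrite -(fmval_comm k (nK Gh)) -[LHS]fmvalZ pw.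
Qed.

(** Compares [<k, x>'], which lies in [T U], with [<x^p, y>'], which lies in [J] but not in
    [T U]. *)
Let t_comm : t%:U \notin img T -> forall J : zmodClosed U, t%:U \in J ->
  {in J, forall u, S u \in J} -> {in J, forall u, T (trace p T u) \in J} ->
  forall k, T k \in J.
Proof.
move=> t'T J tJ SJ TJ k; rewrite -mem_fgroup /= fmval_comm ?nK //.
have Gxp : x ^+ p \in G by rewrite groupX.
apply: (DC_comm dcG (N1 := [group of fgroup (img T)]) (N2 := [group of fgroup J])
  (u := x ^+ p) (v := y)); split=> //.
- by rewrite (subsetP sKG) ?fmodP.
- apply: norm_fgroup => [|u _]; first by rewrite nK // (subsetP sKG) ?fmodP.
  suffices ->: fmod_comm (fmval k) u = 0%R by rewrite rpred0.
  apply: fmod_inj; rewrite fmval_comm ?nK ?(subsetP sKG) ?fmodP //.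
  by apply/eqP/commgP/(centsP abK); rewrite fmodP.
- by apply: norm_fgroup => [|u _]; [apply: nK | apply: img_mem T u].
- by rewrite -fmval_comm ?nK // mem_fgroup (img_mem T).
- by rewrite mem_fgroup_fmod.
- by apply: norm_fgroup => [|u Ju]; [apply: nK | rewrite comm_xp TJ].
- by apply: norm_fgroup => [|u Ju]; [apply: nK | apply: SJ].
- by rewrite mem_fgroup_fmod.
Qed.

Let small_commX : p = 3 -> forall w : U,
  w = T t%:U \/ (exists u, w = T (trace p T u)) ->
  (w *+ p = 0)%R -> T (trace p T w) = 0%R -> D w = 0%R ->
  w \in multiples z%:U.
Proof.
move=> p3 w def_w pw Tw Dw; have Gxp : x ^+ p \in G by rewrite groupX.
have w_xp : commute (fmval w) (x ^+ p).
  apply/commgP/eqP; rewrite -(fmval_comm w (nK Gxp)) comm_xp Tw; exact: fmval0.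
have pwg : fmval w ^+ p = 1 by rewrite -[LHS]fmvalZ pw.
rewrite -mem_cycleU //.
case: def_w => [def_w | [u def_w]]; last first.
  have Gu : fmval u \in G by rewrite (subsetP sKG) ?fmodP.
  move: w_xp pwg; rewrite def_w -comm_xp fmval_comm ?nK // => w_xp pwg.
  apply: small_commG => //; apply: (centsP abK); rewrite ?fmodP //.
  by apply: Kcomm; rewrite ?fmodP.
have cw : commute (fmval w) c.
  apply/commgP/eqP; rewrite -(fmval_comm w (nK Gc)) Dw; exact: fmval0.
have Kdx : d ^ x \in K by rewrite memJ_norm ?nK.
have Kdxx : (d ^ x) ^ x \in K by rewrite (memJ_norm (d ^ x) (nK Gx)).
(* Here [T t] is [d d^x d^(x^2)], which is the expansion of [[c, x^3]], so [w] is a commutator. *)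
suffices def_w3 : fmval w = [~ c, x ^+ p].
  by rewrite def_w3 in cw w_xp pwg *; apply: small_commG.
have ->: [~ c, x ^+ p] = d * (d ^ x * (d ^ x) ^ x).
  rewrite p3 commgEl (expgSr x 2) (conjgM c (x ^+ 2)) (conjgM c x x) x_c (conjMg c d) x_c.
  by rewrite (conjMg (c * d)) (conjMg c d) x_c -(mulgA (c * d)) -(mulgA c) mulKg.
suffices -> : w = (d * (d ^ x * (d ^ x) ^ x))%:U.
  exact: fmodK (groupM Kd (groupM Kdx Kdxx)).
rewrite def_w.
rewrite (fM Kd (groupM Kdx Kdxx)) (fM Kdx Kdxx).
rewrite (fmodJ abK (d ^ x) (nK Gx)) (fmodJ abK d (nK Gx)) !actr_comm.
have [m _ ->] := tE; rewrite /tail p3 (raddfD T) (raddfD T q%:U) /=.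
rewrite (raddfD T) (raddfMn T) /= Tq [fmod_comm x (z%:U *+ m)%R](raddfMn T) /=.
have ->: 'C(p, 2) = p by rewrite p3.
rewrite (z_comm Gx) mul0rn addr0 pzU addr0 p3 (raddfD T d%:U) /=.
rewrite (mulrS d%:U 2) (mulrS (fmod_comm x _) 2) !mulr2n -!addrA.
by congr (_ + (_ + _))%R; rewrite addrCA.
Qed.

Lemma DC_two_generated_contradiction : False.
Proof.
have [m _ t_def] := tE.
apply: (@module_contradiction U p (nil_class G) (nil_class G) T S D
  d%:U q%:U e%:U z%:U p_pr p_le3 pU _ _ _ _ _ _ _ _ _ _ _ _ _ _ _ _ _ t%:U)
  => //.
- exact: nil_comm.
- exact: nil_comm.
- exact: z_comm.
- exact: z_comm.
- by move=> u; apply: D_comm.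
- by exists m.
Qed.

End TwoGenerated.

(** * Reduction to the two-generator case *)

Section Generators.
Variables (gT : finGroupType) (G N : {group gT}) (p : nat) (z0 c : gT).
Hypotheses (p_pr : prime p) (p_le3 : p <= 3) (pG : p.-group G).
Hypotheses (dcG : DC_group G) (nNG : N <| G) (abN : abelian N).
Hypotheses (sNG' : N \subset G^`(1)) (sG2z : G^`(2) \subset <[z0]>).
Hypotheses (Zz0 : z0 \in 'Z(G)) (ord_z0 : #[z0] = p) (G'c : c \in G^`(1)).

Let Gc : c \in G. Proof. exact: subsetP (der_sub 1 G) c G'c. Qed.
Let nN g : g \in G -> g \in 'N(N). Proof. exact: subsetP (normal_norm nNG) g. Qed.
Let z0_cent u g : u \in <[z0]> -> g \in G -> u ^ g = u.
Proof.
move=> zu Gg; have /centP cGu : u \in 'C(G).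
  by apply: subsetP zu; rewrite cycle_subG; case/setIP: Zz0.
by rewrite conjgE (cGu g Gg) mulKg.
Qed.

Let G2c k : k \in N -> [~ k, c] \in <[z0]>.
Proof.
by move=> Nk; apply: (subsetP sG2z); rewrite mem_commg // (subsetP sNG').
Qed.

Lemma comm_commM g h :
    g \in G -> h \in G -> [~ c, g] \in N -> [~ c, h] \in N ->
  [~ c, g * h] \in N /\ [~ [~ c, g * h], c] = [~ [~ c, g], c] * [~ [~ c, h], c].
Proof.
move=> Gg Gh Ng Nh; have Ngh : [~ c, g] ^ h \in N by rewrite memJ_norm ?nN.
rewrite commgMJ groupM //; split=> //.
rewrite commMgJ (z0_cent (G2c Nh)); last first.
  by rewrite (subsetP (normal_sub nNG)).
have: [~ [~ c, g], c] ^ h = [~ [~ c, g], c] by rewrite z0_cent ?G2c.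
rewrite conjRg [c ^ h]conjg_mulR commgMJ.
have /commgP/eqP -> : commute ([~ c, g] ^ h) [~ c, h] by apply: (centsP abN).
rewrite mul1g z0_cent ?G2c ?(subsetP (normal_sub nNG)) // => ->.
apply: (centsP (cycle_abelian z0)); exact: G2c.
Qed.

Lemma comm_commX g j : g \in G -> [~ c, g] \in N ->
  [~ c, g ^+ j] \in N /\ [~ [~ c, g ^+ j], c] = [~ [~ c, g], c] ^+ j.
Proof.
move=> Gg Ng; elim: j => [|j [IHN IHj]].
  by rewrite !expg0 commg1 comm1g group1.
rewrite expgS; have [? ->] := comm_commM Gg (groupX j Gg) Ng IHN.
by rewrite IHj expgS.
Qed.

Lemma nontrivial_generator_contradiction x y :
    G = <[x]> <*> <[y]> :> {set gT} -> [~ x, y] = c ->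
    [~ c, x] \in N -> [~ c, y] \in N -> [~ [~ c, x], c] != 1 ->
  False.
Proof.
move=> defG def_c Nx Ny; set z := [~ _, c] => nz_z.
have [Gx Gy] : x \in G /\ y \in G by rewrite defG; apply: mem_joing_cycles.
have pz : z ^+ p = 1.
  by apply/eqP; rewrite -order_dvdn -ord_z0 orderE cardSg // cycle_subG G2c.
have ord_z : #[z] = p by apply: nt_prime_order.
have def_z : <[z]> = <[z0]>.
  by apply/eqP; rewrite eqEcard cycle_subG G2c // -!orderE ord_z ord_z0 /=.
have [i def_i] : exists i, [~ [~ c, y], c] = z ^+ i.
  by apply/cycleP; rewrite def_z G2c.
(* The exponent [j] is [-i] modulo [p], making [[[c, y'], c] = z^(j + i)] trivial while [[x, y']] is
   still [c]. *)
pose j := (p.-1 * i)%N; pose y' := x ^+ j * y.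
have [Nxj zxj] := comm_commX j Gx Nx.
have [Ny' zy'] := comm_commM (groupX j Gx) Gy Nxj Ny.
have def_c' : [~ x, y'] = c.
  have /commgP/eqP cxj := commuteX j (commute_refl x).
  by rewrite commgMJ def_c cxj conj1g mulg1.
apply: (@DC_two_generated_contradiction gT G N p x y'); rewrite ?def_c' //.
- rewrite defG; apply/eqP; rewrite eqEsubset !join_subG !cycle_subG.
  have [x_in y_in] := mem_joing_cycles x y.
  have [x_in' y_in'] := mem_joing_cycles x y'.
  have y_in2 : y \in <[x]> <*> <[y']>.
    by rewrite -(mulKg (x ^+ j) y) (groupM _ y_in') // groupV groupX.
  by rewrite x_in' y_in2 x_in (groupM (groupX j x_in) y_in).
- by rewrite zy' zxj def_i -expgD -mulSnr prednK ?prime_gt0 // expgM pz expg1n.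
- by rewrite def_z.
- apply: subsetP (G2c Nx); rewrite cycle_subG; exact: Zz0.
Qed.

End Generators.

Lemma DC_pgroup_metabelian n (gT : finGroupType) (G : {group gT}) p :
    #|G| < n -> prime p -> p <= 3 -> p.-group G -> DC_group G ->
  abelian G^`(1).
Proof.
elim: n gT G => // n IHn gT G leGn p_pr p_le3 pG dcG; apply: contraT => not_abG'.
have IHsub (H : {group gT}) : H \proper G -> abelian H^`(1).
  move=> prH; have sHG := proper_sub prH.
  apply: (IHn) => //; last exact: DC_group_sub sHG dcG.
    exact: leq_trans (proper_card prH) _.
  exact: pgroupS pG.
have IHquo (N : {group gT}) : N <| G -> N :!=: 1 -> G^`(2) \subset N.
  move=> nNG ntN; have nNG' : G^`(1) \subset 'N(N).
    exact: subset_trans (der_sub 1 G) (normal_norm nNG).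
  apply: der1_min => //; rewrite -[_ / N]/(G^`(1) / N).
  rewrite quotient_der ?normal_norm //.
  apply: (IHn _ (G / N)%G) => //.
  - exact: leq_trans (ltn_quotient ntN (normal_sub nNG)) _.
  - exact: quotient_pgroup.
  - exact: DC_group_quotient.
have [x [y [Gx Gy defG']]] := DC_der1_cycles dcG.
have defG : G = <[x]> <*> <[y]> :> {set gT}.
  have: <[x]> <*> <[y]> \subset G by rewrite join_subG !cycle_subG Gx.
  rewrite subEproper => /predU1P[<- // | /(IHsub [group of <[x]> <*> <[y]>])].
  by rewrite /= -defG' (negPf not_abG').
have ntG2 : G^`(2) != 1 by apply: contraNneq not_abG' => /commG1P.
have nilG := pgroup_nil pG.
have ntZ : G^`(2) :&: 'Z(G) != 1 by rewrite meet_center_nil ?der_normal.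
have pZ : p.-group (G^`(2) :&: 'Z(G)).
  by apply: pgroupS pG; rewrite subIset ?der_sub.
have [_ p_dvd _] := pgroup_pdiv pZ ntZ.
have [z0 /setIP[G2z0 Zz0] ord_z0] := Cauchy p_pr p_dvd.
have sG2z : G^`(2) \subset <[z0]>.
  apply: (IHquo <[z0]>%G); first by rewrite sub_center_normal ?cycle_subG.
  by rewrite -cardG_gt1 -orderE ord_z0 prime_gt1.
pose A g := [group of <[g]> <*> G^`(1)].
have abA g : g \in G -> abelian (A g)^`(1).
  move=> Gg; apply: IHsub; rewrite properEneq join_subG cycle_subG Gg der_sub !andbT.
  (* If [<g>G'] were [G], then [g] would generate [G] modulo the Frattini subgroup, and [G] would be
     cyclic. *)
  apply: contraNneq not_abG' => defA.
  have: <<[set g]>> = G.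
    apply: Phi_nongen; apply/eqP; rewrite eqEsubset join_subG Phi_sub sub1set Gg /=.
    rewrite -{1}defA /A /= join_subG cycle_subG mem_gen ?inE ?eqxx ?orbT //=.
    by rewrite (Phi_joing pG) -joingA joing_subl.
  move=> defGg; apply: abelianS (der_sub 1 G) _.
  by rewrite -defGg; apply: (cycle_abelian g).
have nA g : g \in G -> (A g)^`(1) <| G.
  move=> Gg; apply: char_normal_trans (der_char 1 _) _.
  by apply: sub_der1_normal; rewrite ?joing_subr // join_subG cycle_subG Gg der_sub.
pose c := [~ x, y].
have G'c : c \in G^`(1) by apply: mem_commg.
have Ac g : [~ c, g] \in (A g)^`(1).
  by apply: mem_commg; rewrite mem_gen // inE ?G'c ?cycle_id ?orbT.
(* The larger of the abelian normal subgroups [(A x)'] and [(A y)'] contains both commutators. *)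
have [N [nNG abN sNG' Nx Ny]] : exists N : {group gT},
    [/\ N <| G, abelian N, N \subset G^`(1), [~ c, x] \in N & [~ c, y] \in N].
  have sA g : g \in G -> A g \subset G by rewrite join_subG cycle_subG der_sub => ->.
  have [sd | sd] := dcG (A x) (A y) (sA x Gx) (sA y Gy).
    exists (A y)^`(1)%G; split; rewrite ?nA ?abA ?dergS ?sA //.
    exact: subsetP sd _ (Ac x).
  exists (A x)^`(1)%G; split; rewrite ?nA ?abA ?dergS ?sA //.
  exact: subsetP sd _ (Ac y).
have contra x1 y1 := @nontrivial_generator_contradiction gT G N p z0 c p_pr
  p_le3 pG dcG nNG abN sNG' sG2z Zz0 ord_z0 G'c x1 y1.
have [zx | nz_zx] := eqVneq [~ [~ c, x], c] 1; last by case: (contra x y).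
have [zy | nz_zy] := eqVneq [~ [~ c, y], c] 1; last first.
  have [Nyx zyx] := comm_commM nNG abN sNG' sG2z Zz0 G'c Gy Gx Ny Nx.
  (* The pair [y x], [y] has the same commutator [c], and [[[c, y x], c] = [[c, y], c]] is
     nontrivial. *)
  case: (contra (y * x) y) => //.
  - rewrite defG; apply/eqP; rewrite eqEsubset !join_subG !cycle_subG.
    have [yx_in y_in] := mem_joing_cycles (y * x) y.
    have [x_in' y_in'] := mem_joing_cycles x y.
    have x_in : x \in <[y * x]> <*> <[y]>.
      by rewrite -{1}(mulKg y x) (groupM _ yx_in) // groupV.
    by rewrite x_in y_in y_in' (groupM y_in' x_in').
  - by rewrite commMgJ commgg conj1g mul1g.
  - by rewrite zyx zx mulg1.
(* In the remaining case [[c, x]] and [[c, y]] are central in [G'], so [G'] lies in the abelian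
   group [<c>Z(G')]. *)
have nG' : G \subset 'N(G^`(1)) by apply: der_norm.
have sG'cN : G^`(1) \subset <[c]> * N.
  rewrite defG' der1_joing_cycles_mod // (subsetP (normal_norm nNG)) //.
have ZN k : k \in N -> [~ k, c] = 1 -> k \in 'Z(G^`(1)).
  move=> Nk kc; rewrite inE (subsetP sNG') //=.
  apply/centP=> g /(subsetP sG'cN)/mulsgP[_ m /cycleP[i ->] Nm ->].
  apply: commuteM; first exact/commuteX/commgP/eqP.
  exact: (centsP abN).
have nZ g : g \in G -> g \in 'N('Z(G^`(1))).
  exact: subsetP (char_norm_trans (center_char _) nG') g.
have sG'Z : G^`(1) \subset <[c]> * 'Z(G^`(1)).
  by rewrite {1}defG' (der1_joing_cycles_mod (M := 'Z(G^`(1))%G)) ?nZ ?ZN.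
case/negP: not_abG'; apply: abelianS sG'Z _.
rewrite abelianM cycle_abelian center_abelian /= centsC.
by rewrite cycle_subG; apply: subsetP G'c; rewrite centsC subsetIr.
Qed.

Theorem mainTheorem4 (gT : finGroupType) (G : {group gT}) (p : nat)
    (p_prime : prime p) (p_le3 : (p <= 3)%N)
    (pG : (p.-group G)%g) (dcG : DC_group G) :
  metabelian G.
Proof. exact: DC_pgroup_metabelian (ltnSn _) p_prime p_le3 pG dcG. Qed.
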